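(* Let $(X,d)$ and $(Y,\rho)$ be two metric spaces. Then the following conditions are equivalent. (1) Every Cauchy-Lipschitz function $f:(X,d)\to(Y,\rho)$ is quasi-Cauchy Lipschitz. (2) Every real valued Cauchy-Lipschitz function defined on $X$ is quasi-Cauchy Lipschitz. (3) Every Bourbaki quasi-Cauchy sequence in $X$ has a Cauchy subsequence.
   Context: A sequence $(x_n)$ in a metric space $(X,d)$ is quasi-Cauchy if for every $\varepsilon>0$ there is $n_0$ such that $d(x_{n+1},x_n)<\varepsilon$ for all $n\ge n_0$. A function $f:(X,d)\to(Y,\rho)$ is quasi-Cauchy Lipschitz if for any quasi-Cauchy sequence $(x_n)$ in $X$ there exists $\lambda>0$ such that $\rho(f(x_k),f(x_{k+1}))\le\lambda d(x_k,x_{k+1})$ for all $k\in\mathbb{N}$. It is Cauchy-Lipschitz if $f$ is Lipschitz when restricted to the range of each Cauchy sequence in $X$. For $\varepsilon>0$ and $p\in X$, $B^\infty_\varepsilon(p)$ is the set of points $q\in X$ for which there are finitely many points $p=p_0,p_1,\dots,p_n=q$ in $X$ with $d(p_{i-1},p_i)<\varepsilon$ for $i=1,\dots,n$. A sequence $(x_n)$ is Bourbaki quasi-Cauchy in $X$ if for every $\varepsilon>0$ there exist $n_0\in\mathbb{N}$ and $p\in X$ such that $x_n\in B^\infty_\varepsilon(p)$ for every $n\ge n_0$.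
   Formalization: The metric space Y is not fixed in advance: condition (1) is read as ''for every metric space Y, every Cauchy-Lipschitz function from X to Y is quasi-Cauchy Lipschitz'', since for a fixed one-point Y and X the real line, (1) holds while (3) fails. *)

(* Defs.v *)
From mathcomp Require Import all_boot all_order all_algebra.
From mathcomp Require Import all_classical all_reals topology.
Set Implicit Arguments.
Unset Strict Implicit.
Unset Printing Implicit Defensive.
Import Order.TTheory GRing.Theory Num.Theory.
Local Open Scope classical_set_scope.
Local Open Scope ring_scope.

Definition quasi_cauchy (R : realType) (X : metricType R) (x : nat -> X) : Prop :=
  forall e : R, 0 < e ->
    exists n0 : nat, forall n : nat, (n0 <= n)%N -> mdist (x n.+1) (x n) < e.

(* The library's [lipschitz_on] is only available between normed modules. *)
Definition metric_lipschitz_on (R : realType) (X Y : metricType R)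
    (f : X -> Y) (A : set X) : Prop :=
  exists2 K : R, 0 < K &
    forall p q : X, A p -> A q -> mdist (f p) (f q) <= K * mdist p q.

Definition cauchy_lipschitz (R : realType) (X Y : metricType R)
    (f : X -> Y) : Prop :=
  forall x : nat -> X, cauchy (x @ \oo) -> metric_lipschitz_on f (range x).

Definition quasi_cauchy_lipschitz (R : realType) (X Y : metricType R)
    (f : X -> Y) : Prop :=
  forall x : nat -> X, quasi_cauchy x ->
    exists2 K : R, 0 < K &
      forall k : nat, mdist (f (x k)) (f (x k.+1)) <= K * mdist (x k) (x k.+1).

(* The chain p = p_0, p_1, ..., p_n = q is [p :: s], with [s] possibly empty. *)
Definition chain_ball (R : realType) (X : metricType R) (e : R) (p : X) : set X :=
  [set q | exists2 s : seq X, path (fun a b : X => mdist a b < e) p s & last p s = q].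

Definition bourbaki_quasi_cauchy (R : realType) (X : metricType R)
    (x : nat -> X) : Prop :=
  forall e : R, 0 < e ->
    exists (n0 : nat) (p : X), forall n : nat, (n0 <= n)%N -> chain_ball e p (x n).

Definition has_cauchy_subsequence (R : realType) (X : metricType R)
    (x : nat -> X) : Prop :=
  exists2 phi : nat -> nat, {homo phi : m n / (m < n)%N} & cauchy ((x \o phi) @ \oo).

(* Main.v *)
Require Import Defs.
From mathcomp Require Import all_boot all_order all_algebra.
From mathcomp Require Import all_classical all_reals topology.
From mathcomp Require Import interval_inference num_normedtype lra.
Set Implicit Arguments.
Unset Strict Implicit.
Import Order.TTheory GRing.Theory Num.Theory.
Local Open Scope classical_set_scope.
Local Open Scope ring_scope.

(* (3) => (1): a quasi-Cauchy x along which no constant works has a subsequence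
   of steps x(phi n), x(phi n + 1) that f stretches by more than n.  It is
   Bourbaki quasi-Cauchy, so it may be refined to a Cauchy sequence; the
   interleaving of x(phi n) and x(phi n + 1) is then Cauchy as well, and f is
   not Lipschitz on its range.

   (2) => (3): let x be Bourbaki quasi-Cauchy without Cauchy subsequence.  Take
   an ultrafilter U on the indices refining the cofinite filter.  If x_*U were
   Cauchy a Cauchy subsequence could be extracted, so for some e no e-ball is in
   x_*U, which yields an e-separated subsequence a, thin enough for
   a(n), a(n+1) to be joined by a 1/(n+1)-chain.  Concatenating the chains gives
   a quasi-Cauchy sequence y through all a(n).  With d = e/4, the supremum of
   the disjointly supported tents n * max(0, d - dist(a(n), .)) is
   Cauchy-Lipschitz, as a Cauchy sequence meets finitely many of them, but it
   has slope n on the step by which y leaves a(n). *)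

(** * Extraction of subsequences *)

Lemma leq_homo_ltn (phi : nat -> nat) (n : nat) :
  {homo phi : i j / (i < j)%N} -> (n <= phi n)%N.
Proof.
move=> hphi; elim: n => // n IHn.
exact: leq_ltn_trans IHn (hphi _ _ (ltnSn n)).
Qed.

(** Dependent choice started at index 0, which is not itself chosen through [P]; hence the shifts by
    [succn] in the applications. *)
Lemma subsequence_choice (P : nat -> nat -> nat -> Prop) :
  (forall n m, exists2 k, (m < k)%N & P n m k) ->
  exists2 phi : nat -> nat, {homo phi : i j / (i < j)%N} &
    forall n, P n (phi n) (phi n.+1).
Proof.
move=> HP.
have /choice[g Hg] (u : nat * nat) : exists k, (u.2 < k)%N /\ P u.1 u.2 k.
  by have [k ? ?] := HP u.1 u.2; exists k.
pose phi := fix phi n := if n is n'.+1 then g (n', phi n') else 0%N.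
exists phi => [|n]; last exact: (Hg (n, phi n)).2.
by apply: homo_ltn => [? ? ?|n]; [exact: ltn_trans|exact: (Hg (n, phi n)).1].
Qed.

(** * Cauchy subsequences, chains and quasi-Cauchy sequences *)

Section metric_sequences.
Context {R : realType} {X : metricType R}.
Implicit Types (x : nat -> X) (e : R).

Lemma cauchy_mdistP x : cauchy (x @ \oo) <->
  forall e, 0 < e -> exists N, forall m n, (N <= m)%N -> (N <= n)%N ->
    mdist (x m) (x n) < e.
Proof.
split=> [/cauchy_ballP xC e e0|xC].
  have [[A B] /= [[M _ MA] [N _ NB]] AB] := xC e e0.
  exists (maxn M N) => m n; rewrite !geq_max => /andP[Mm _] /andP[_ Nn].
  by have := AB (x m, x n) (conj (MA m Mm) (NB n Nn)); rewrite /= ballEmdist.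
apply: cauchy_exP => e /xC[N HN]; exists (x N), N => // n /= Nn.
by rewrite ballEmdist /=; exact: HN.
Qed.

(** Distance from a whole initial segment spares a record of the terms already chosen; the free [N]
    allows thinning. *)
Lemma separated_of_no_cauchy_subsequence x : ~ has_cauchy_subsequence x ->
  exists2 e, 0 < e & forall m N, exists2 k, (N < k)%N &
    forall i, (i <= m)%N -> e <= mdist (x i) (x k).
Proof.
move=> xNC.
have [U [UU oU]] := ultraFilterLemma eventually_filter.
have capU (A : nat -> set nat) m : (forall i, U (A i)) ->
    U [set k | forall i, (i <= m)%N -> A i k].
  move=> UA; have Um : U [set k | forall i : 'I_m.+1, A i k].
    exact: (@filter_forall _ _ (fun i : 'I_m.+1 => A i) U _ (fun=> UA _)).
  by apply: filterS Um => k Ak i im; exact: (Ak (Ordinal (im : (i < m.+1)%N))).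
have freq (A : set nat) N : U A -> exists2 k, (N < k)%N & A k.
  move=> UA; have UN : U [set k | (N < k)%N] by apply: oU; exists N.+1.
  by have [k [? ?]] := filter_ex (filterI UA UN); exists k.
have [xC|] := pselect (forall e, 0 < e -> exists p, U [set k | mdist p (x k) < e]).
  case: xNC.
  have /choice[p Up] n : exists p, U [set k | mdist p (x k) < n.+1%:R^-1].
    by apply: xC; rewrite invr_gt0.
  (* The centers [p i] need not be related: at stage [n] the new term is close to all of [p 0], ...,
     [p n], so each ball contains a tail. *)
  have [n m|phi hphi Hphi] := @subsequence_choice (fun n _ k =>
      forall i, (i <= n)%N -> mdist (p i) (x k) < i.+1%:R^-1).
    by apply: freq; apply: (capU (fun i => [set k | mdist (p i) (x k) < i.+1%:R^-1])).
  exists (phi \o succn) => [i j ij|]; first exact: hphi.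
  apply/cauchy_mdistP => e e0; have e20 : 0 < e / 2 by rewrite divr_gt0.
  have [N _ HN] := near_infty_natSinv_lt (PosNum e20).
  have dp m : (N <= m)%N -> mdist (p N) (x (phi m.+1)) < e / 2.
    by move=> Nm; apply: lt_trans (Hphi m _ Nm) (HN N _) => /=.
  exists N => m n Nm Nn /=.
  rewrite (splitr e) (le_lt_trans (metric_triangle _ (p N) _))//.
  by rewrite ltrD ?dp// metric_sym dp.
move=> /existsNP[e] /not_implyP[e0 /forallNP Ue]; exists e => // m N.
apply: freq; apply: (capU (fun i => [set k | e <= mdist (x i) (x k)])) => i.
have [/Ue//|] := in_ultra_setVsetC [set k | mdist (x i) (x k) < e] UU.
by apply: filterS => k /=; rewrite leNgt => /negP.
Qed.

Lemma chain_ball_trans e p q r :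
  chain_ball e p q -> chain_ball e q r -> chain_ball (X := X) e p r.
Proof.
move=> [s ps <-] [t qt <-]; exists (s ++ t); last by rewrite last_cat.
by rewrite cat_path ps.
Qed.

Lemma chain_ball_sym e p q : chain_ball e p q -> chain_ball (X := X) e q p.
Proof.
move=> [s ps <-]; exists (rev (belast p s)).
  rewrite rev_path; apply: sub_path ps => a b; by rewrite metric_sym.
by case: s {ps} => //= a s; rewrite rev_cons last_rcons.
Qed.

Lemma quasi_cauchy_bourbaki x : quasi_cauchy x -> bourbaki_quasi_cauchy x.
Proof.
move=> xQ e /xQ[N HN]; exists N, (x N); elim=> [|n IHn].
  by rewrite leqn0 => /eqP->; exists [::].
rewrite leq_eqVlt => /predU1P[<-|Nn]; first by exists [::].
apply: chain_ball_trans (IHn Nn) _.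
by exists [:: x n.+1] => //=; rewrite andbT metric_sym HN.
Qed.

Lemma bourbaki_subsequence x (phi : nat -> nat) :
  {homo phi : i j / (i < j)%N} -> bourbaki_quasi_cauchy x ->
  bourbaki_quasi_cauchy (x \o phi).
Proof.
move=> hphi xB e /xB[N [p HN]]; exists N, p => n Nn /=.
by apply: HN; apply: leq_trans Nn (leq_homo_ltn n hphi).
Qed.

Lemma bourbaki_separated_subsequence x :
  bourbaki_quasi_cauchy x -> ~ has_cauchy_subsequence x ->
  exists a : nat -> X,
    (exists2 e, 0 < e & forall i j, i != j -> e <= mdist (a i) (a j)) /\
    forall n, chain_ball n.+1%:R^-1 (a n) (a n.+1).
Proof.
move=> xB /separated_of_no_cauchy_subsequence[e e0 He].
have /choice[N HN] n : exists N p, forall m, (N <= m)%N ->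
    chain_ball n.+1%:R^-1 p (x m).
  by apply: xB; rewrite invr_gt0.
(* Both [phi n.+1] and [phi n.+2] are then at least [N n], so their terms are joined through a
   common center. *)
have [n m|phi hphi Hphi] := @subsequence_choice (fun n m k =>
    (N n <= k)%N /\ forall i, (i <= m)%N -> e <= mdist (x i) (x k)).
  have [k + Hk] := He m (maxn m (N n)).
  by rewrite gtn_max => /andP[mk Nk]; exists k => //; split => //; exact: ltnW.
exists (x \o phi \o succn); split.
  exists e => // i j.
  wlog ij : i j / (i < j)%N => [H|_].
    case: (ltngtP i j) => // ij _; first by apply: H => //; rewrite ltn_eqF.
    by rewrite metric_sym; apply: H => //; rewrite ltn_eqF.
  by apply: (Hphi j).2; rewrite /= (ltnW_homo hphi).
move=> n; have [p Hp] := HN n.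
apply: (@chain_ball_trans _ _ p); first apply: chain_ball_sym;
  apply: Hp => /=; have [Nn _] := Hphi n => //.
by apply: leq_trans Nn _; apply: ltnW; exact: hphi.
Qed.

(** Even [k] gives a term of the subsequence, odd [k] its successor in [x], and the steps of [x]
    tend to 0. *)
Lemma cauchy_interleave x (phi : nat -> nat) :
  {homo phi : i j / (i < j)%N} -> quasi_cauchy x ->
  cauchy ((x \o phi) @ \oo) ->
  cauchy ((fun k => x (phi k./2 + odd k)%N) @ \oo).
Proof.
move=> hphi xQ /cauchy_mdistP xC; apply/cauchy_mdistP => e e0.
have e30 : 0 < e / 3 by rewrite divr_gt0.
have [M HM] := xQ _ e30; have [N HN] := xC _ e30.
have step i (b : bool) : (M <= i)%N -> mdist (x (phi i + b)%N) (x (phi i)) < e / 3.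
  move=> Mi; case: b; last by rewrite addn0 mdistxx.
  by rewrite addn1 HM// (leq_trans Mi)// leq_homo_ltn.
exists (maxn M N).*2 => m n; rewrite -!geq_half_double !geq_max => /andP[Mm Nm] /andP[Mn Nn].
have h1 := step _ (odd m) Mm; have h2 := step _ (odd n) Mn.
have h3 := HN _ _ Nm Nn.
have t1 := metric_triangle (x (phi m./2 + odd m)%N) (x (phi m./2)) (x (phi n./2 + odd n)%N).
have t2 := metric_triangle (x (phi m./2)) (x (phi n./2)) (x (phi n./2 + odd n)%N).
rewrite metric_sym in h2; move: h3 => /= h3.
by lra.
Qed.

(** Distinct consecutive points force every chain to have a step, so [phi], the starting time of
    each chain, is strictly increasing. *)
Lemma quasi_cauchy_concat (a : nat -> X) :
  (forall n, a n != a n.+1) ->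
  (forall n, chain_ball n.+1%:R^-1 (a n) (a n.+1)) ->
  exists y phi, [/\ quasi_cauchy y, {homo phi : i j / (i < j)%N} &
    forall n, y (phi n) = a n].
Proof.
move=> aN aC.
have /choice[s Hs] n : exists s,
    path (fun p q : X => mdist p q < n.+1%:R^-1) (a n) s /\
    last (a n) s = a n.+1.
  by have [s ? ?] := aC n; exists s.
have s_gt0 n : (0 < size (s n))%N.
  by case: (s n) (Hs n) (aN n) => //= -[_ ->]; rewrite eqxx.
(* The state (n, i) stands for the i-th point of the n-th chain. *)
pose step (u : nat * nat) :=
  if (u.2.+1 < size (s u.1))%N then (u.1, u.2.+1) else (u.1.+1, 0%N).
pose st := fix st k := if k is k'.+1 then step (st k') else (0%N, 0%N).
pose pt (u : nat * nat) := nth (a u.1) (a u.1 :: s u.1) u.2.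
(* The end of a chain is represented only as the start of the next one, hence the strict bound. *)
have st_lt k : ((st k).2 < size (s (st k).1))%N.
  elim: k => [|k IHk]; first exact: s_gt0.
  by rewrite /= /step; case: ifP => // _; exact: s_gt0.
have st_homo : {homo (fun k => (st k).1) : i j / (i <= j)%N}.
  apply: homo_leq => // [? ? ?|k]; first exact: leq_trans.
  by rewrite /= /step; case: ifP => //= _.
have pt_step k : mdist (pt (st k)) (pt (st k.+1)) < (st k).1.+1%:R^-1.
  rewrite /=; move: (st k) (st_lt k) => [n i] /= ilt.
  have [/pathP path_s last_s] := Hs n.
  have := path_s (a n) i ilt; rewrite /pt /step /=; case: ifP => [//|].
  move=> /negbT; rewrite -leqNgt => ige /=.
  have -> : i = (size (s n)).-1 by apply/eqP; rewrite -eqSS prednK// eqn_leq ilt ige.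
  by rewrite nth_last last_s.
pose phi n := (\sum_(j < n) size (s j))%N.
have phiS n : phi n.+1 = (phi n + size (s n))%N by rewrite /phi big_ord_recr.
have st_phi n : st (phi n) = (n, 0%N).
  elim: n => [|n IHn]; first by rewrite /phi big_ord0.
  have st_phiD i : (i < size (s n))%N -> st (phi n + i)%N = (n, i).
    elim: i => [|i IHi] ilt; first by rewrite addn0.
    by rewrite addnS /= IHi ?(ltnW ilt)// /step /= ilt.
  by rewrite phiS -(prednK (s_gt0 n)) addnS /= st_phiD ?prednK// /step /= prednK// ltnn.
exists (pt \o st), phi; split => [e e0||n]; last by rewrite /= st_phi.
- have [N _ HN] := near_infty_natSinv_lt (PosNum e0).
  exists (phi N) => k Nk; rewrite metric_sym.
  apply: lt_trans (pt_step k) (HN _ _) => /=.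
  by have := st_homo _ _ Nk; rewrite st_phi.
- apply: homo_ltn => [? ? ?|n]; first exact: ltn_trans.
  by rewrite phiS -[ltnLHS]addn0 ltn_add2l.
Qed.

End metric_sequences.

(** * From Cauchy subsequences to Lipschitz bounds *)

Section subsequences_to_lipschitz.
Context {R : realType} {X Y : metricType R}.

(** The steps up to [m] have a common constant, so large stretches must occur beyond [m]. *)
Lemma not_lipschitz_steps_frequently (f : X -> Y) (x : nat -> X) (C : R) (m : nat) :
  (forall K : R, 0 < K -> exists k,
    K * mdist (x k) (x k.+1) < mdist (f (x k)) (f (x k.+1))) ->
  exists2 k, (m < k)%N &
    C * mdist (x k) (x k.+1) < mdist (f (x k)) (f (x k.+1)).
Proof.
move=> Hx; apply: contrapT => Nex.
have /choice[c Hc] k : exists c, 0 <= c /\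
    mdist (f (x k)) (f (x k.+1)) <= c * mdist (x k) (x k.+1).
  have [xk|xk] := eqVneq (x k) (x k.+1).
    by exists 0; rewrite xk !mdistxx mulr0.
  exists (mdist (f (x k)) (f (x k.+1)) / mdist (x k) (x k.+1)).
  by rewrite divr_ge0 ?mdist_ge0// divfK// gt_eqF// mdist_gt0.
have sum_ge0 : 0 <= \sum_(i < m.+1) c i by apply: sumr_ge0 => i _; exact: (Hc i).1.
(* This constant is positive, exceeds [C] and bounds every [c k] with [k <= m]. *)
have [|k] := Hx (`|C| + 1 + \sum_(i < m.+1) c i).
  by rewrite ltr_wpDr// ltr_wpDl.
rewrite ltNge => /negP; apply.
have [km|mk] := leqP k m.
  apply: le_trans (Hc k).2 _; rewrite ler_wpM2r ?mdist_ge0//.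
  rewrite (bigD1 (Ordinal (km : (k < m.+1)%N)))//= addrCA lerDl.
  by rewrite !addr_ge0// sumr_ge0// => i _; exact: (Hc i).1.
have : mdist (f (x k)) (f (x k.+1)) <= C * mdist (x k) (x k.+1).
  by rewrite leNgt; apply/negP => lt_k; apply: Nex; exists k.
move=> /le_trans; apply; rewrite ler_wpM2r ?mdist_ge0//.
by rewrite -addrA ler_wpDr ?ler_norm// addr_ge0.
Qed.

Lemma quasi_cauchy_lipschitz_of_subsequences (f : X -> Y) :
  (forall x : nat -> X, bourbaki_quasi_cauchy x -> has_cauchy_subsequence x) ->
  cauchy_lipschitz f -> quasi_cauchy_lipschitz f.
Proof.
move=> subC fL x xQ; apply: contrapT => NK.
have steep (K : R) : 0 < K -> exists k,
    K * mdist (x k) (x k.+1) < mdist (f (x k)) (f (x k.+1)).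
  move=> K0; apply: contrapT => Nk; apply: NK; exists K => // k.
  by rewrite leNgt; apply/negP => lt_k; apply: Nk; exists k.
have [n m|phi hphi Hphi] := @subsequence_choice (fun n _ k =>
    n%:R * mdist (x k) (x k.+1) < mdist (f (x k)) (f (x k.+1))).
  exact: not_lipschitz_steps_frequently.
have hphiS : {homo (phi \o succn) : i j / (i < j)%N} by move=> i j ij; exact: hphi.
have [psi hpsi xpsiC] :=
  subC _ (bourbaki_subsequence hphiS (quasi_cauchy_bourbaki xQ)).
pose chi := phi \o succn \o psi.
have hchi : {homo chi : i j / (i < j)%N} by move=> i j /hpsi/hphiS.
have [K K0 HK] := fL _ (cauchy_interleave hchi xQ xpsiC).
have [n Kn] : exists n : nat, K < n%:R.
  by exists (Num.truncn K).+1; exact: truncnS_gt.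
have zE (b : bool) : range (fun k => x (chi k./2 + odd k)%N) (x (chi n + b)%N).
  exists (b + n.*2)%N => //=.
  by rewrite half_bit_double oddD odd_double addbF oddb.
have := HK _ _ (zE false) (zE true); rewrite addn0 addn1 leNgt => /negP; apply.
(* [f] stretches the step at [chi n] by more than [psi n], and [psi n >= n > K]. *)
apply: le_lt_trans (Hphi (psi n)); rewrite ler_wpM2r ?mdist_ge0//.
by rewrite (le_trans (ltW Kn))// ler_nat leq_homo_ltn.
Qed.

End subsequences_to_lipschitz.

(** * Tents over a separated sequence *)

Section tents.
Context {R : realType} {X : metricType R} (a : nat -> X) (d : R).
Hypotheses (d_gt0 : 0 < d)
  (a_sep : forall i j, i != j -> 4 * d <= mdist (a i) (a j)).

Definition tent (n : nat) (p : X) : R := n%:R * Num.max 0 (d - mdist (a n) p).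

Lemma tent_ge0 n p : 0 <= tent n p.
Proof. by rewrite mulr_ge0// le_max lexx. Qed.

Lemma tent_eq0 n p : d <= mdist (a n) p -> tent n p = 0.
Proof. by move=> dp; rewrite /tent max_l ?mulr0// subr_le0. Qed.

Lemma tent_lipschitz n p q : tent n p - tent n q <= n%:R * mdist p q.
Proof.
rewrite -mulrBr ler_wpM2l//.
have := metric_triangle (a n) p q; have := mdist_ge0 p q.
by rewrite /Num.max; do 2 case: ifPn; lra.
Qed.

(** The radius is twice that of a tent, which leaves room to move by [d] along a Cauchy sequence. *)
Lemma near_center_unique m n p :
  mdist (a m) p < 2 * d -> mdist (a n) p < 2 * d -> m = n.
Proof.
move=> mp np; apply/eqP; apply: contraT => /a_sep.
by have := metric_triangle (a m) p (a n); rewrite (metric_sym p); lra.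
Qed.

Lemma tent_upper_envelope : exists f : X -> R^o,
  (forall n p, tent n p <= f p) /\ (forall p, exists n, f p = tent n p).
Proof.
have /choice[f Hf] p : exists v : R^o,
    (forall n, tent n p <= v) /\ (exists n, v = tent n p).
  have [[n np]|Nn] := pselect (exists n, mdist (a n) p < d).
    exists (tent n p); split; last by exists n.
    move=> m; have [->//|mn] := eqVneq m n.
    rewrite (tent_eq0 (n := m)) ?tent_ge0//.
    rewrite leNgt; apply/negP => mp; move/eqP: mn; apply.
    by apply: (@near_center_unique m n p); move: d_gt0; lra.
  (* The tent of index 0 vanishes identically, so it attains the value 0. *)
  exists 0; split; last by exists 0%N; rewrite /tent mul0r.
  by move=> n; rewrite tent_eq0// leNgt; apply/negP => np; apply: Nn; exists n.
by exists f; split=> [n p|p]; [exact: (Hf p).1|exact: (Hf p).2].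
Qed.

(** A tail stays within [d] of [z N], so a tent met by it is centered within [2 * d] of [z N], which
    leaves one candidate. *)
Lemma cauchy_meets_finitely_many_tents (z : nat -> X) : cauchy (z @ \oo) ->
  exists M, forall k n, mdist (a n) (z k) < d -> (n <= M)%N.
Proof.
move=> /cauchy_mdistP /(_ _ d_gt0)[N HN].
have /choice[g Hg] k : exists g, forall n, mdist (a n) (z k) < 2 * d -> (n <= g)%N.
  have [[n nk]|Nn] := pselect (exists n, mdist (a n) (z k) < 2 * d).
    by exists n => m mk; rewrite (near_center_unique mk nk).
  by exists 0%N => n nk; case: Nn; exists n.
exists (\max_(k < N.+1) g k) => k n nk.
have [kN|Nk] := leqP k N.
  apply: leq_trans (leq_bigmax (Ordinal (kN : (k < N.+1)%N))) => /=.
  by apply: Hg; move: d_gt0; lra.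
apply: leq_trans (leq_bigmax (@ord_max N)) => /=; apply: Hg.
have := metric_triangle (a n) (z k) (z N).
by have := HN k N (ltnW Nk) (leqnn N); lra.
Qed.

Variable f : X -> R^o.
Hypotheses (tent_le : forall n p, tent n p <= f p)
  (tent_eq : forall p, exists n, f p = tent n p).

Lemma tent_envelope_cauchy_lipschitz : cauchy_lipschitz f.
Proof.
move=> z /cauchy_meets_finitely_many_tents[M HM].
(* A tent active at [p] has slope at most [M], and [f q] lies above that same tent. The successor
   keeps the constant positive when [M] is 0. *)
have half p q : range z p -> f p - f q <= M.+1%:R * mdist p q.
  move=> [k _ <-]; have [n fn] := tent_eq (z k).
  have [nk|nk] := ltP (mdist (a n) (z k)) d; last first.
    rewrite fn tent_eq0// sub0r (@le_trans _ _ 0) ?mulr_ge0 ?mdist_ge0//.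
    by rewrite oppr_le0 (le_trans (tent_ge0 0 q)).
  rewrite fn (@le_trans _ _ (tent n (z k) - tent n q))//; first by rewrite lerB.
  apply: le_trans (tent_lipschitz _ _ _) _.
  by rewrite ler_wpM2r ?mdist_ge0// ler_nat leqW// (HM k).
exists M.+1%:R => // p q zp zq.
have -> : mdist (f p) (f q) = `|f q - f p| by [].
by rewrite ler_norml lerNl opprB half//= metric_sym half.
Qed.

(** Within [d] of [a n] only tent [n] can be active, and it falls linearly from its peak
    [n%:R * d]. *)
Lemma tent_envelope_slope n q : mdist (a n) q < d ->
  n%:R * mdist (a n) q <= mdist (f (a n)) (f q).
Proof.
move=> nq; have [m fq] := tent_eq q.
have fqn : f q <= tent n q.
  rewrite fq; have [->//|mn] := eqVneq m n.
  rewrite (tent_eq0 (n := m)) ?tent_ge0// leNgt; apply/negP => mq.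
  move/eqP: mn; apply.
  by apply: (@near_center_unique m n q); move: d_gt0; lra.
rewrite (metric_sym (f _)); apply: le_trans (ler_norm _).
have := tent_le n (a n); move: fqn; rewrite /tent mdistxx subr0.
rewrite !max_r ?(ltW d_gt0) ?subr_ge0 ?(ltW nq)//.
by rewrite mulrBr; lra.
Qed.

End tents.

(** * Chains against tents, and the equivalence *)

Lemma subsequences_of_quasi_cauchy_lipschitz (R : realType) (X : metricType R) :
  (forall f : X -> R^o, cauchy_lipschitz f -> quasi_cauchy_lipschitz f) ->
  forall x : nat -> X, bourbaki_quasi_cauchy x -> has_cauchy_subsequence x.
Proof.
move=> fQ x xB; apply: contrapT => xNC.
have [a [[e e0 a_sep] a_chain]] := bourbaki_separated_subsequence xB xNC.
pose d := e / 4; have d0 : 0 < d by rewrite divr_gt0.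
have {}a_sep i j : i != j -> 4 * d <= mdist (a i) (a j).
  by rewrite /d mulrC divfK//; exact: a_sep.
have a_neq n : a n != a n.+1.
  by rewrite -mdist_gt0 (lt_le_trans _ (a_sep _ _ _)) ?mulr_gt0// ltn_eqF.
have [y [phi [yQ hphi yphi]]] := quasi_cauchy_concat a_neq a_chain.
have [f [f_ge f_eq]] := tent_upper_envelope d0 a_sep.
have [K K0 HK] := fQ f (tent_envelope_cauchy_lipschitz d0 a_sep f_ge f_eq) y yQ.
have [N HN] := yQ _ d0.
(* With [n >= N] the steps of [y] from time [phi n] on are shorter than [d]; with [n > K] the tent
   is too steep for [K]. *)
pose n := maxn N (Num.truncn K).+1.
(* A chain may linger at [a n]; a step of positive length is needed to cancel it, and [y] must leave
   [a n] to reach [a n.+1]. *)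
have [k [phik yk ykS]] : exists k, [/\ (phi n <= k)%N, y k = a n & y k.+1 <> a n].
  apply: contrapT => Nk.
  have yD i : y (phi n + i)%N = a n.
    elim: i => [|i IHi]; first by rewrite addn0.
    apply: contrapT => yi; apply: Nk; exists (phi n + i)%N.
    by rewrite leq_addr -addnS.
  have := a_neq n; rewrite -(yphi n.+1) -(subnKC (ltnW (hphi _ _ (ltnSn n)))).
  by rewrite yD eqxx.
have dk : mdist (a n) (y k.+1) < d.
  rewrite -yk metric_sym HN//; apply: leq_trans phik.
  by apply: leq_trans (leq_homo_ltn n hphi); exact: leq_maxl.
have fk := tent_envelope_slope d0 a_sep f_ge f_eq dk.
have := HK k; rewrite yk => /(le_trans fk).
rewrite ler_pM2r; last by rewrite mdist_gt0; apply/eqP => /esym.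
rewrite leNgt (lt_le_trans (truncnS_gt K))// ler_nat; exact: leq_maxr.
Qed.

(* The target Y is quantified inside the first condition: for a fixed Y (say, a
   one-point space) that condition may hold trivially while the others fail.
   [R^o] is the real line with the distance `|y - x|. *)
Theorem theorem4p3 (R : realType) (X : metricType R) :
  [<-> forall (Y : metricType R) (f : X -> Y),
         cauchy_lipschitz f -> quasi_cauchy_lipschitz f;
       forall f : X -> R^o,
         cauchy_lipschitz f -> quasi_cauchy_lipschitz f;
       forall x : nat -> X,
         bourbaki_quasi_cauchy x -> has_cauchy_subsequence x].
Proof.
tfae; first by move=> H f; exact: H.
  exact: subsequences_of_quasi_cauchy_lipschitz.
by move=> H Y f; exact: quasi_cauchy_lipschitz_of_subsequences.
Qed.
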